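(* Assume that for every object $X$ of $\mathbf{C}$ a free uniform-iteration algebra $KX$ exists and is stable. Let $f\colon X\to KY+X$ and $g\colon X\to KY$. Then (i) $f^{\langle\dagger}\sqsubseteq f^\dagger\circ\mathrm{fst}$ in $\mathbf{C}(X\times\mathbb{N},KY)$, and (ii) if $f^{\langle\dagger}\sqsubseteq g\circ\mathrm{fst}$, then $f^\dagger\sqsubseteq g$.
   Context: $\mathbf{C}$ is an extensive category with finite products, a stable natural number object $(\mathbb{N},o,s)$ (supporting primitive recursion) and exponentials $X^{\mathbb{N}}$. A uniform-iteration algebra is an object $A$ with an operator $f\mapsto f^\dagger$ ($f\colon Z\to A+Z$, $f^\dagger\colon Z\to A$) satisfying (Fixpoint) $f^\dagger=[\mathrm{id},f^\dagger]f$ and (Uniformity) $(\mathrm{id}+h)f=gh\Rightarrow f^\dagger=g^\dagger h$; morphisms $h$ satisfy $hf^\dagger=((h+\mathrm{id})f)^\dagger$. $KX$ with unit $\eta$ is free on $X$; $KY$ is stable if for every $X$, $\mathrm{fst}\colon X\times KY\to X$ with $\mathrm{id}\times\eta$ is a free uniform-iteration algebra over $\mathrm{fst}\colon X\times Y\to X$ in $\mathbf{C}/X$. $\mathbb{K}$ has unit $\eta$ and Kleisli lifting $f^*$ the unique algebra morphism with $f^*\eta=f$; strength $\tau$ is the unique morphism with $\tau(\mathrm{id}\times\eta)=\eta$ and $\tau(\mathrm{id}\times h^\dagger)=((\tau+\mathrm{id})\mathrm{dstr}(\mathrm{id}\times h))^\dagger$. For $f\colon X\to KY$, $g\colon X\to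 KZ$: $f\downharpoonright g=\mathrm{fst}^*\tau\langle f,g\rangle$; $f\sqsubseteq f'$ iff $f=f'\downharpoonright f$. The divergence constant is $\bot=(\mathrm{inr}\colon1\to KY+1)^\dagger\colon1\to KY$. Bounded iteration: for $f\colon X\to KY+X$, $f^{\langle\dagger}\colon X\times\mathbb{N}\to KY$ is defined by primitive recursion: $f^{\langle\dagger}(x,o)=\bot$ and $f^{\langle\dagger}(x,s\,n)=a$ if $f(x)=\mathrm{inl}\,a$, $=f^{\langle\dagger}(y,n)$ if $f(x)=\mathrm{inr}\,y$ (i.e. $f^{\langle\dagger}(\mathrm{id}\times s)=[\mathrm{fst},f^{\langle\dagger}]\,\mathrm{dstl}\,(f\times\mathrm{id})$). *)

(* Defs.v *)
From Stdlib Require Import ProofIrrelevance Setoid.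

Set Implicit Arguments.
Unset Strict Implicit.
Unset Printing Implicit Defensive.

Declare Scope cat_scope.
Delimit Scope cat_scope with cat.
Local Open Scope cat_scope.

Reserved Notation "X ~> Y" (at level 68, no associativity).
Reserved Notation "g ∘ f" (at level 40, left associativity).
Reserved Notation "f ⊕ g" (at level 36, left associativity).
Reserved Notation "f ⊗ g" (at level 34, left associativity).
Reserved Notation "X × Y" (at level 34, left associativity).
Reserved Notation "⟨ f , g ⟩" (at level 0, f at level 99, g at level 99).
Reserved Notation "f †" (at level 1, left associativity, format "f †").

Record Category := {
  Ob :> Type;
  Hom : Ob -> Ob -> Type;
  id : forall X, Hom X X;
  comp : forall X Y Z, Hom Y Z -> Hom X Y -> Hom X Z;
  id_l : forall X Y (f : Hom X Y), comp (id Y) f = f;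
  id_r : forall X Y (f : Hom X Y), comp f (id X) = f;
  comp_assoc : forall X Y Z W (h : Hom Z W) (g : Hom Y Z) (f : Hom X Y),
    comp (comp h g) f = comp h (comp g f) }.

Arguments Hom {_} _ _.
Arguments id {_ X}.
Arguments comp {_ X Y Z} _ _.

Notation "X ~> Y" := (Hom X Y) : type_scope.
Notation "g ∘ f" := (comp g f) : cat_scope.

(* Universal properties are carried as data (a mediating morphism together with
   its uniqueness), so that mediating morphisms need no choice principle. *)
Record IsCoproduct (C : Category) (A B S : C) (i : A ~> S) (j : B ~> S) := {
  cp_copair : forall Z, A ~> Z -> B ~> Z -> S ~> Z;
  cp_in1 : forall Z (f : A ~> Z) (g : B ~> Z), cp_copair f g ∘ i = f;
  cp_in2 : forall Z (f : A ~> Z) (g : B ~> Z), cp_copair f g ∘ j = g;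
  cp_unique : forall Z (f : A ~> Z) (g : B ~> Z) (h : S ~> Z),
    h ∘ i = f -> h ∘ j = g -> h = cp_copair f g }.

Record IsPullback (C : Category) (P A B S : C)
    (p : P ~> A) (q : P ~> B) (f : A ~> S) (g : B ~> S) := {
  pb_comm : f ∘ p = g ∘ q;
  pb_gap : forall W (u : W ~> A) (v : W ~> B), f ∘ u = g ∘ v -> W ~> P;
  pb_gap1 : forall W (u : W ~> A) (v : W ~> B) (e : f ∘ u = g ∘ v),
    p ∘ pb_gap e = u;
  pb_gap2 : forall W (u : W ~> A) (v : W ~> B) (e : f ∘ u = g ∘ v),
    q ∘ pb_gap e = v;
  pb_unique : forall W (u : W ~> A) (v : W ~> B) (e : f ∘ u = g ∘ v) (h : W ~> P),
    p ∘ h = u -> q ∘ h = v -> h = pb_gap e }.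

Record CocartesianCategory := {
  cc_cat :> Category;
  initial : cc_cat;
  from_initial : forall X : cc_cat, initial ~> X;
  from_initial_unique : forall (X : cc_cat) (f : initial ~> X), f = from_initial X;
  sum : cc_cat -> cc_cat -> cc_cat;
  in1 : forall X Y, X ~> sum X Y;
  in2 : forall X Y, Y ~> sum X Y;
  sum_coproduct : forall X Y, IsCoproduct (in1 X Y) (in2 X Y) }.

Arguments in1 {_ X Y}.
Arguments in2 {_ X Y}.

Notation "X + Y" := (sum X Y) : cat_scope.

Definition copair (C : CocartesianCategory) (X Y Z : C) (f : X ~> Z) (g : Y ~> Z) :
    (X + Y) ~> Z :=
  cp_copair (sum_coproduct X Y) f g.

Definition sum_map (C : CocartesianCategory) (X Y X' Y' : C) (f : X ~> X') (g : Y ~> Y') :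
    (X + Y) ~> (X' + Y') :=
  copair (in1 ∘ f) (in2 ∘ g).

Notation "f ⊕ g" := (sum_map f g) : cat_scope.

Record IsExtensive (C : CocartesianCategory) := {
  ext_pullback1 : forall (X Y Z : C) (f : Z ~> (X + Y)),
    {P : C & {p : P ~> Z & {q : P ~> X & IsPullback p q f in1}}};
  ext_pullback2 : forall (X Y Z : C) (f : Z ~> (X + Y)),
    {P : C & {p : P ~> Z & {q : P ~> Y & IsPullback p q f in2}}};
  ext_coproduct : forall (X Y A B Z : C) (f : Z ~> (X + Y))
      (i : A ~> Z) (a : A ~> X) (j : B ~> Z) (b : B ~> Y),
    IsPullback i a f in1 -> IsPullback j b f in2 -> IsCoproduct i j;
  ext_pullbacks : forall (X Y A B Z : C) (f : Z ~> (X + Y))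
      (i : A ~> Z) (a : A ~> X) (j : B ~> Z) (b : B ~> Y),
    f ∘ i = in1 ∘ a -> f ∘ j = in2 ∘ b -> IsCoproduct i j ->
    IsPullback i a f in1 * IsPullback j b f in2 }.

Record UniIterAlg (C : CocartesianCategory) := {
  carrier :> C;
  iter : forall Z : C, Z ~> (carrier + Z) -> Z ~> carrier;
  iter_fixpoint : forall (Z : C) (f : Z ~> (carrier + Z)),
    iter f = copair id (iter f) ∘ f;
  iter_uniform : forall (Z W : C) (f : Z ~> (carrier + Z)) (g : W ~> (carrier + W))
      (h : Z ~> W),
    (id ⊕ h) ∘ f = g ∘ h -> iter f = iter g ∘ h }.

Notation "f †" := (iter f) : cat_scope.

Definition is_alg_morphism (C : CocartesianCategory) (A B : UniIterAlg C) (h : A ~> B) : Prop :=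
  forall (Z : C) (f : Z ~> (A + Z)), h ∘ f† = ((h ⊕ id) ∘ f)†.

Record IsFree (C : CocartesianCategory) (Y : C) (A : UniIterAlg C) (eta : Y ~> A) := {
  lift : forall (B : UniIterAlg C), Y ~> B -> A ~> B;
  lift_morphism : forall (B : UniIterAlg C) (f : Y ~> B), is_alg_morphism (lift f);
  lift_unit : forall (B : UniIterAlg C) (f : Y ~> B), lift f ∘ eta = f;
  lift_unique : forall (B : UniIterAlg C) (f : Y ~> B) (h : A ~> B),
    is_alg_morphism h -> h ∘ eta = f -> h = lift f }.

Record FreeAlg (C : CocartesianCategory) (Y : C) := {
  free_alg :> UniIterAlg C;
  eta : Y ~> free_alg;
  free_is_free : IsFree eta }.

Section Slice.
Variables (C : CocartesianCategory) (X : C).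

Record SliceOb := { so_dom : C; so_map : so_dom ~> X }.

Record SliceHom (A B : SliceOb) := {
  sh_map :> so_dom A ~> so_dom B;
  sh_comm : so_map B ∘ sh_map = so_map A }.

Lemma slice_hom_eq (A B : SliceOb) (f g : SliceHom A B) :
  sh_map f = sh_map g -> f = g.
Proof.
destruct f as [f ef], g as [g eg]; simpl; intros e; destruct e.
now rewrite (proof_irrelevance _ ef eg).
Qed.

Definition slice_id (A : SliceOb) : SliceHom A A :=
  Build_SliceHom (id_r (so_map A)).

Lemma slice_comp_comm (A B D : SliceOb) (g : SliceHom B D) (f : SliceHom A B) :
  so_map D ∘ (g ∘ f) = so_map A.
Proof. now rewrite <- comp_assoc, !sh_comm. Qed.

Definition slice_comp (A B D : SliceOb) (g : SliceHom B D) (f : SliceHom A B) :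
    SliceHom A D :=
  Build_SliceHom (slice_comp_comm g f).

Definition slice_cat : Category.
Proof.
refine (@Build_Category SliceOb SliceHom slice_id slice_comp _ _ _);
  intros; apply slice_hom_eq; simpl.
- apply id_l.
- apply id_r.
- apply comp_assoc.
Defined.

Definition slice_initial : slice_cat :=
  @Build_SliceOb (initial C) (from_initial X).

Definition slice_sum (A B : slice_cat) : slice_cat :=
  @Build_SliceOb (so_dom A + so_dom B) (copair (so_map A) (so_map B)).

Definition slice_in1 (A B : slice_cat) : A ~> slice_sum A B :=
  @Build_SliceHom A (slice_sum A B) in1 (cp_in1 _ _ _).

Definition slice_in2 (A B : slice_cat) : B ~> slice_sum A B :=
  @Build_SliceHom B (slice_sum A B) in2 (cp_in2 _ _ _).

Lemma slice_copair_comm (A B D : slice_cat) (f : A ~> D) (g : B ~> D) :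
  so_map D ∘ copair (sh_map f) (sh_map g) = copair (so_map A) (so_map B).
Proof.
apply cp_unique; rewrite comp_assoc; unfold copair;
  rewrite ?cp_in1, ?cp_in2; apply sh_comm.
Qed.

Definition slice_sum_coproduct (A B : slice_cat) :
  IsCoproduct (slice_in1 A B) (slice_in2 A B).
Proof.
refine (@Build_IsCoproduct slice_cat A B (slice_sum A B)
  (slice_in1 A B) (slice_in2 A B)
  (fun D f g => @Build_SliceHom (slice_sum A B) D _ (slice_copair_comm f g)) _ _ _);
  intros; apply slice_hom_eq; simpl.
- apply cp_in1.
- apply cp_in2.
- subst; apply cp_unique; reflexivity.
Defined.

Definition slice : CocartesianCategory.
Proof.
refine (@Build_CocartesianCategory slice_cat slice_initial
  (fun A => @Build_SliceHom slice_initial A (from_initial (so_dom A)) _) _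
  slice_sum slice_in1 slice_in2 slice_sum_coproduct).
Unshelve.
- intros A f; apply slice_hom_eq; apply from_initial_unique.
- apply from_initial_unique.
Defined.

End Slice.

Record BicartesianCategory := {
  bc_cc :> CocartesianCategory;
  terminal : bc_cc;
  bang : forall X : bc_cc, X ~> terminal;
  bang_unique : forall (X : bc_cc) (f : X ~> terminal), f = bang X;
  prod : bc_cc -> bc_cc -> bc_cc;
  fst : forall X Y, prod X Y ~> X;
  snd : forall X Y, prod X Y ~> Y;
  pair : forall X Y Z : bc_cc, Z ~> X -> Z ~> Y -> Z ~> prod X Y;
  fst_pair : forall (X Y Z : bc_cc) (f : Z ~> X) (g : Z ~> Y),
    fst X Y ∘ pair f g = f;
  snd_pair : forall (X Y Z : bc_cc) (f : Z ~> X) (g : Z ~> Y),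
    snd X Y ∘ pair f g = g;
  pair_unique : forall (X Y Z : bc_cc) (f : Z ~> X) (g : Z ~> Y) (h : Z ~> prod X Y),
    fst X Y ∘ h = f -> snd X Y ∘ h = g -> h = pair f g }.

Arguments terminal {_}.
Arguments bang {_ X}.
Arguments fst {_ X Y}.
Arguments snd {_ X Y}.

Notation "X × Y" := (prod X Y) : cat_scope.
Notation "⟨ f , g ⟩" := (pair f g) : cat_scope.

Definition prod_map (C : BicartesianCategory) (X Y X' Y' : C) (f : X ~> X') (g : Y ~> Y') :
    (X × Y) ~> (X' × Y') :=
  ⟨f ∘ fst, g ∘ snd⟩.

Notation "f ⊗ g" := (prod_map f g) : cat_scope.

(* Stability is the parameter [X] in the recursion principle: it says that
   [X × N] is a natural number object of the slice over [X]. *)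
Record StableNNO (C : BicartesianCategory) := {
  nno_ob :> C;
  zero : terminal ~> nno_ob;
  succ : nno_ob ~> nno_ob;
  nno_rec : forall X Y : C, X ~> Y -> Y ~> Y -> (X × nno_ob) ~> Y;
  nno_zero : forall (X Y : C) (f : X ~> Y) (g : Y ~> Y),
    nno_rec f g ∘ ⟨id, zero ∘ bang⟩ = f;
  nno_succ : forall (X Y : C) (f : X ~> Y) (g : Y ~> Y),
    nno_rec f g ∘ (id ⊗ succ) = g ∘ nno_rec f g;
  nno_unique : forall (X Y : C) (f : X ~> Y) (g : Y ~> Y) (h : (X × nno_ob) ~> Y),
    h ∘ ⟨id, zero ∘ bang⟩ = f -> h ∘ (id ⊗ succ) = g ∘ h -> h = nno_rec f g }.

Record Exponentials (C : BicartesianCategory) (N : C) := {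
  exp : C -> C;
  ev : forall X, (exp X × N) ~> X;
  curry : forall X Z : C, (Z × N) ~> X -> Z ~> exp X;
  ev_curry : forall (X Z : C) (f : (Z × N) ~> X), ev X ∘ (curry f ⊗ id) = f;
  curry_unique : forall (X Z : C) (f : (Z × N) ~> X) (h : Z ~> exp X),
    ev X ∘ (h ⊗ id) = f -> h = curry f }.

Record AmbientCategory := {
  ac_bc :> BicartesianCategory;
  extensive : IsExtensive ac_bc;
  nat_ob : StableNNO ac_bc;
  nat_exp : Exponentials nat_ob }.

Arguments nat_ob {_}.
Arguments nat_exp {_}.

Section Coproducts.
Variable C : CocartesianCategory.

Lemma copair_in1 (X Y Z : C) (f : X ~> Z) (g : Y ~> Z) : copair f g ∘ in1 = f.
Proof. apply cp_in1. Qed.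

Lemma copair_in2 (X Y Z : C) (f : X ~> Z) (g : Y ~> Z) : copair f g ∘ in2 = g.
Proof. apply cp_in2. Qed.

Lemma copair_in1_r (X Y Z W : C) (f : X ~> Z) (g : Y ~> Z) (k : W ~> X) :
  copair f g ∘ (in1 ∘ k) = f ∘ k.
Proof. now rewrite <- comp_assoc, copair_in1. Qed.

Lemma copair_in2_r (X Y Z W : C) (f : X ~> Z) (g : Y ~> Z) (k : W ~> Y) :
  copair f g ∘ (in2 ∘ k) = g ∘ k.
Proof. now rewrite <- comp_assoc, copair_in2. Qed.

Lemma comp_copair (X Y Z W : C) (f : X ~> Z) (g : Y ~> Z) (h : Z ~> W) :
  h ∘ copair f g = copair (h ∘ f) (h ∘ g).
Proof. apply cp_unique; now rewrite comp_assoc, ?copair_in1, ?copair_in2. Qed.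

Lemma comp_copair_r (X Y Z W V : C) (f : X ~> Z) (g : Y ~> Z) (h : Z ~> W)
    (k : V ~> (X + Y)) :
  h ∘ (copair f g ∘ k) = copair (h ∘ f) (h ∘ g) ∘ k.
Proof. now rewrite <- comp_assoc, comp_copair. Qed.

Lemma copair_ext (X Y Z : C) (h k : (X + Y) ~> Z) :
  h ∘ in1 = k ∘ in1 -> h ∘ in2 = k ∘ in2 -> h = k.
Proof.
intros e1 e2; transitivity (copair (k ∘ in1) (k ∘ in2)).
- now apply cp_unique.
- symmetry; now apply cp_unique.
Qed.

Lemma copair_in (X Y : C) : copair (@in1 C X Y) in2 = id.
Proof. apply copair_ext; now rewrite ?copair_in1, ?copair_in2, id_l. Qed.

End Coproducts.

Section Products.
Variable C : BicartesianCategory.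

Lemma fst_pair_r (X Y Z W : C) (f : Z ~> X) (g : Z ~> Y) (k : W ~> Z) :
  fst ∘ (⟨f, g⟩ ∘ k) = f ∘ k.
Proof. now rewrite <- comp_assoc, fst_pair. Qed.

Lemma snd_pair_r (X Y Z W : C) (f : Z ~> X) (g : Z ~> Y) (k : W ~> Z) :
  snd ∘ (⟨f, g⟩ ∘ k) = g ∘ k.
Proof. now rewrite <- comp_assoc, snd_pair. Qed.

Lemma pair_comp (X Y Z W : C) (f : Z ~> X) (g : Z ~> Y) (k : W ~> Z) :
  ⟨f, g⟩ ∘ k = ⟨f ∘ k, g ∘ k⟩.
Proof. apply pair_unique; now rewrite ?fst_pair_r, ?snd_pair_r. Qed.

Lemma pair_ext (X Y Z : C) (h k : Z ~> (X × Y)) :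
  fst ∘ h = fst ∘ k -> snd ∘ h = snd ∘ k -> h = k.
Proof.
intros e1 e2; transitivity ⟨fst ∘ k, snd ∘ k⟩.
- now apply pair_unique.
- symmetry; now apply pair_unique.
Qed.

Lemma pair_fst_snd (X Y : C) : ⟨@fst C X Y, snd⟩ = id.
Proof. symmetry; apply pair_unique; apply id_r. Qed.

Lemma bang_comp (X Y : C) (f : X ~> Y) : bang ∘ f = bang.
Proof. apply bang_unique. Qed.

End Products.

Ltac cat_norm :=
  unfold sum_map, prod_map;
  repeat rewrite ?comp_assoc, ?id_l, ?id_r, ?copair_in1, ?copair_in2, ?copair_in1_r,
    ?copair_in2_r, ?fst_pair, ?snd_pair, ?fst_pair_r, ?snd_pair_r, ?pair_comp,
    ?comp_copair, ?comp_copair_r, ?bang_comp, ?pair_fst_snd, ?copair_in.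

Section Distributivity.
Variable C : AmbientCategory.

Definition dstr_coproduct (X Y Z : C) :
  IsCoproduct (id ⊗ in1 : (X × Y) ~> (X × (Y + Z))) (id ⊗ in2 : (X × Z) ~> _).
Proof.
apply (ext_coproduct (extensive C)) with (f := snd) (a := snd) (b := snd).
- refine (@Build_IsPullback C _ _ _ _ (id ⊗ in1) snd snd in1 _
    (fun W u v _ => ⟨fst ∘ u, v⟩) _ _ _).
  + now cat_norm.
  + intros W u v e; apply pair_ext; cat_norm; [reflexivity | now symmetry].
  + intros; now cat_norm.
  + intros W u v e h <- <-; apply pair_ext; now cat_norm.
- refine (@Build_IsPullback C _ _ _ _ (id ⊗ in2) snd snd in2 _
    (fun W u v _ => ⟨fst ∘ u, v⟩) _ _ _).
  + now cat_norm.
  + intros W u v e; apply pair_ext; cat_norm; [reflexivity | now symmetry].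
  + intros; now cat_norm.
  + intros W u v e h <- <-; apply pair_ext; now cat_norm.
Defined.

Definition dstl_coproduct (X Y Z : C) :
  IsCoproduct (in1 ⊗ id : (X × Z) ~> ((X + Y) × Z)) (in2 ⊗ id : (Y × Z) ~> _).
Proof.
apply (ext_coproduct (extensive C)) with (f := fst) (a := fst) (b := fst).
- refine (@Build_IsPullback C _ _ _ _ (in1 ⊗ id) fst fst in1 _
    (fun W u v _ => ⟨v, snd ∘ u⟩) _ _ _).
  + now cat_norm.
  + intros W u v e; apply pair_ext; cat_norm; [now symmetry | reflexivity].
  + intros; now cat_norm.
  + intros W u v e h <- <-; apply pair_ext; now cat_norm.
- refine (@Build_IsPullback C _ _ _ _ (in2 ⊗ id) fst fst in2 _
    (fun W u v _ => ⟨v, snd ∘ u⟩) _ _ _).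
  + now cat_norm.
  + intros W u v e; apply pair_ext; cat_norm; [now symmetry | reflexivity].
  + intros; now cat_norm.
  + intros W u v e h <- <-; apply pair_ext; now cat_norm.
Defined.

Definition dstr (X Y Z : C) : (X × (Y + Z)) ~> (X × Y + X × Z) :=
  cp_copair (dstr_coproduct X Y Z) in1 in2.

Definition dstl (X Y Z : C) : ((X + Y) × Z) ~> (X × Z + Y × Z) :=
  cp_copair (dstl_coproduct X Y Z) in1 in2.

End Distributivity.

Arguments dstr {_ X Y Z}.
Arguments dstl {_ X Y Z}.

Section DistributivityFacts.
Variable C : AmbientCategory.

Lemma dstr_in1 (W X Y Z : C) (u : W ~> X) (v : W ~> Y) :
  dstr ∘ ⟨u, @in1 _ Y Z ∘ v⟩ = in1 ∘ ⟨u, v⟩.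
Proof.
replace ⟨u, in1 ∘ v⟩ with ((id ⊗ @in1 _ Y Z) ∘ ⟨u, v⟩) by now cat_norm.
unfold dstr; now rewrite <- comp_assoc, cp_in1.
Qed.

Lemma dstr_in2 (W X Y Z : C) (u : W ~> X) (v : W ~> Z) :
  dstr ∘ ⟨u, @in2 _ Y Z ∘ v⟩ = in2 ∘ ⟨u, v⟩.
Proof.
replace ⟨u, in2 ∘ v⟩ with ((id ⊗ @in2 _ Y Z) ∘ ⟨u, v⟩) by now cat_norm.
unfold dstr; now rewrite <- comp_assoc, cp_in2.
Qed.

Lemma dstl_in1 (W X Y Z : C) (u : W ~> X) (v : W ~> Z) :
  dstl ∘ ⟨@in1 _ X Y ∘ u, v⟩ = in1 ∘ ⟨u, v⟩.
Proof.
replace ⟨in1 ∘ u, v⟩ with ((@in1 _ X Y ⊗ id) ∘ ⟨u, v⟩) by now cat_norm.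
unfold dstl; now rewrite <- comp_assoc, cp_in1.
Qed.

Lemma dstl_in2 (W X Y Z : C) (u : W ~> Y) (v : W ~> Z) :
  dstl ∘ ⟨@in2 _ X Y ∘ u, v⟩ = in2 ∘ ⟨u, v⟩.
Proof.
replace ⟨in2 ∘ u, v⟩ with ((@in2 _ X Y ⊗ id) ∘ ⟨u, v⟩) by now cat_norm.
unfold dstl; now rewrite <- comp_assoc, cp_in2.
Qed.

Lemma dstr_ext (X Y Z W : C) (h k : (X × (Y + Z)) ~> W) :
  h ∘ (id ⊗ in1) = k ∘ (id ⊗ in1) -> h ∘ (id ⊗ in2) = k ∘ (id ⊗ in2) -> h = k.
Proof.
intros e1 e2.
rewrite (cp_unique (dstr_coproduct X Y Z) e1 e2).
symmetry; now apply cp_unique.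
Qed.

Lemma dstl_ext (X Y Z W : C) (h k : ((X + Y) × Z) ~> W) :
  h ∘ (in1 ⊗ id) = k ∘ (in1 ⊗ id) -> h ∘ (in2 ⊗ id) = k ∘ (in2 ⊗ id) -> h = k.
Proof.
intros e1 e2.
rewrite (cp_unique (dstl_coproduct X Y Z) e1 e2).
symmetry; now apply cp_unique.
Qed.

End DistributivityFacts.

Section Stability.
Variables (C : BicartesianCategory) (X : C).

Definition slice_prod (A : C) : slice X := @Build_SliceOb C X (X × A) fst.

Definition slice_iter_map (A : UniIterAlg C) (Z : slice X)
    (f : Z ~> (slice_prod A + Z)) : so_dom Z ~> (X × A) :=
  ⟨so_map Z, ((snd ⊕ id) ∘ sh_map f)†⟩.

Definition slice_iter (A : UniIterAlg C) (Z : slice X)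
    (f : Z ~> (slice_prod A + Z)) : Z ~> slice_prod A :=
  @Build_SliceHom C X Z (slice_prod A) (slice_iter_map f) (fst_pair _ _).

(* The uniform-iteration algebra structure that [fst : X × A ~> X] inherits
   from [A] in the slice over [X]. *)
Definition slice_alg (A : UniIterAlg C) : UniIterAlg (slice X).
Proof.
refine (@Build_UniIterAlg (slice X) (slice_prod A) (@slice_iter A) _ _).
- intros Z f; apply slice_hom_eq; simpl; unfold slice_iter_map.
  change (⟨so_map Z, ((snd ⊕ id) ∘ sh_map f)†⟩ =
    copair id ⟨so_map Z, ((snd ⊕ id) ∘ sh_map f)†⟩ ∘ sh_map f).
  apply pair_ext; cat_norm.
  + symmetry; apply (sh_comm f).
  + etransitivity; [apply iter_fixpoint | now cat_norm].
- intros Z W f g h e; apply slice_hom_eq; simpl; unfold slice_iter_map.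
  apply (f_equal (@sh_map C X _ _)) in e.
  change ((id ⊕ sh_map h) ∘ sh_map f = sh_map g ∘ sh_map h) in e.
  apply pair_ext; cat_norm.
  + symmetry; apply sh_comm.
  + apply iter_uniform.
    transitivity ((snd ⊕ id) ∘ ((id ⊕ sh_map h) ∘ sh_map f)); [now cat_norm |].
    etransitivity; [exact (f_equal (comp (snd ⊕ id)) e) | now cat_norm].
Defined.

Lemma slice_unit_comm (Y A : C) (u : Y ~> A) :
  fst ∘ ((id : X ~> X) ⊗ u) = fst.
Proof. now cat_norm. Qed.

Definition slice_unit (Y : C) (A : UniIterAlg C) (u : Y ~> A) :
    slice_prod Y ~> slice_alg A :=
  @Build_SliceHom C X (slice_prod Y) (slice_prod A) (id ⊗ u) (slice_unit_comm u).

End Stability.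

Definition Stable (C : BicartesianCategory) (Y : C) (KY : FreeAlg Y) : Type :=
  forall X : C, IsFree (slice_unit X (eta KY)).

Record StableFreeAlgs (C : BicartesianCategory) := {
  free :> forall X : C, FreeAlg X;
  free_stable : forall X : C, Stable (free X) }.

Section Monad.
Variables (C : AmbientCategory) (K : StableFreeAlgs C).

Definition kleisli (X Y : C) (f : X ~> K Y) : K X ~> K Y :=
  lift (free_is_free (K X)) f.

Definition is_strength (X Y : C) (t : (X × K Y) ~> K (X × Y)) : Prop :=
  t ∘ (id ⊗ eta (K Y)) = eta (K (X × Y)) /\
  forall (Z : C) (h : Z ~> (K Y + Z)),
    t ∘ (id ⊗ h†) = ((t ⊕ id) ∘ (dstr ∘ (id ⊗ h)))†.

Lemma strength_gen_comm (X Y : C) :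
  fst ∘ ⟨fst, eta (K (X × Y))⟩ = (fst : (X × Y) ~> X).
Proof. apply fst_pair. Qed.

Definition strength_gen (X Y : C) : slice_prod X Y ~> slice_alg X (K (X × Y)) :=
  @Build_SliceHom C X (slice_prod X Y) (slice_prod X (K (X × Y)))
    ⟨fst, eta (K (X × Y))⟩ (strength_gen_comm X Y).

Definition strength (X Y : C) : (X × K Y) ~> K (X × Y) :=
  snd ∘ sh_map (lift (free_stable K Y X) (strength_gen X Y)).

Lemma strengthP (X Y : C) : is_strength (strength X Y).
Proof.
set (l := lift (free_stable K Y X) (strength_gen X Y)).
assert (lu : sh_map l ∘ (id ⊗ eta (K Y)) = ⟨fst, eta (K (X × Y))⟩).
{ exact (f_equal (@sh_map C X _ _)
    (lift_unit (free_stable K Y X) (strength_gen X Y))). }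
split.
- unfold strength; rewrite comp_assoc; fold l.
  etransitivity; [exact (f_equal (comp snd) lu) | apply snd_pair].
- intros Z h.
  assert (hc : copair fst fst ∘ (dstr ∘ (id ⊗ h)) = (fst : (X × Z) ~> X)).
  { rewrite <- comp_assoc.
    replace (copair fst fst ∘ dstr) with (@fst C X (K Y + Z)).
    - now cat_norm.
    - apply dstr_ext; cat_norm; rewrite ?dstr_in1, ?dstr_in2; now cat_norm. }
  set (f := @Build_SliceHom C X (slice_prod X Z)
    (slice_sum (slice_prod X (K Y)) (slice_prod X Z)) _ hc :
    slice_prod X Z ~> (slice_alg X (K Y) + slice_prod X Z)).
  pose proof (f_equal (@sh_map C X _ _)
    (lift_morphism (free_stable K Y X) (strength_gen X Y) f)) as lm.
  fold l in lm; simpl in lm; unfold slice_iter_map in lm; simpl in lm.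
  assert (e : ((snd ⊕ id) ∘ (dstr ∘ (id ⊗ h)))† = h† ∘ @snd C X Z).
  { apply iter_uniform; rewrite <- !comp_assoc.
    replace ((id ⊕ snd) ∘ (snd ⊕ id) ∘ dstr) with (@snd C X (K Y + Z)).
    - now cat_norm.
    - apply dstr_ext; cat_norm; rewrite ?dstr_in1, ?dstr_in2; now cat_norm. }
  rewrite e in lm.
  apply (f_equal (fun k => snd ∘ k)) in lm; rewrite snd_pair in lm.
  unfold strength; fold l; unfold prod_map at 1; rewrite id_l, comp_assoc.
  etransitivity; [exact lm |].
  f_equal; change (sh_map (l ⊕ id)) with (sh_map l ⊕ @id C (X × Z)).
  now cat_norm.
Qed.

Lemma strength_unique (X Y : C) (t : (X × K Y) ~> K (X × Y)) :
  is_strength t -> t = strength X Y.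
Proof.
intros [tu ti].
assert (tc : so_map (slice_prod X (K (X × Y))) ∘ ⟨fst, t⟩ =
  so_map (slice_prod X (K Y))) by apply fst_pair.
set (h := @Build_SliceHom C X (slice_prod X (K Y)) (slice_prod X (K (X × Y))) _ tc :
  slice_alg X (K Y) ~> slice_alg X (K (X × Y))).
unfold strength; rewrite <- (lift_unique (free_stable K Y X) (h := h)).
- symmetry; apply snd_pair.
- intros Z f; apply slice_hom_eq.
  change (⟨fst, t⟩ ∘ ⟨so_map Z, ((snd ⊕ id) ∘ sh_map f)†⟩ =
    ⟨so_map Z, ((snd ⊕ id) ∘ ((⟨fst, t⟩ ⊕ @id C (so_dom Z)) ∘ sh_map f))†⟩).
  set (q := so_map Z); set (p := sh_map f).
  assert (ep : copair fst q ∘ p = q) by exact (sh_comm f).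
  apply pair_ext; cat_norm; [reflexivity |].
  transitivity (t ∘ (id ⊗ ((snd ⊕ id) ∘ p)†) ∘ ⟨q, id⟩); [now cat_norm |].
  rewrite ti; symmetry; apply iter_uniform; cat_norm.
  transitivity (copair (in1 ∘ t) in2 ∘ (copair in1 (in2 ∘ ⟨q, id⟩) ∘ p));
    [now cat_norm |].
  transitivity (copair (in1 ∘ t) in2 ∘ (dstr ∘ ⟨q, copair (in1 ∘ snd) in2 ∘ p⟩));
    [| now cat_norm].
  f_equal.
  transitivity (dstr ∘ ⟨copair fst q ∘ p, copair (in1 ∘ snd) in2 ∘ p⟩);
    [| now rewrite ep].
  rewrite <- pair_comp, <- comp_assoc; f_equal.
  apply copair_ext; rewrite comp_assoc, pair_comp; cat_norm.
  + rewrite dstr_in1; now cat_norm.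
  + rewrite <- (id_r (@in2 C (K Y) (so_dom Z))), dstr_in2; now cat_norm.
- apply slice_hom_eq; simpl; cat_norm; now rewrite <- tu; cat_norm.
Qed.

(* [restrict f g] is [f ⇂ g] and [below f f'] is [f ⊑ f']. *)
Definition restrict (X Y Z : C) (f : X ~> K Y) (g : X ~> K Z) : X ~> K Y :=
  kleisli (fst : (K Y × Z) ~> K Y) ∘ strength (K Y) Z ∘ ⟨f, g⟩.

Definition below (X Y : C) (f f' : X ~> K Y) : Prop := f = restrict f' f.

End Monad.

Notation "f ⊑ g" := (below f g) (at level 70, no associativity) : cat_scope.

Section BoundedIteration.
Variables (C : AmbientCategory) (A : UniIterAlg C).
Local Notation N := (nno_ob (@nat_ob C)).

Definition diverge : terminal ~> A := (in2 : terminal ~> (A + terminal))†.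

Section Fix_f.
Variables (X : C) (f : X ~> (A + X)).

Definition is_bounded_iter (b : (X × N) ~> A) : Prop :=
  b ∘ ⟨id, zero nat_ob ∘ bang⟩ = diverge ∘ bang /\
  b ∘ (id ⊗ succ nat_ob) = copair fst b ∘ dstl ∘ (f ⊗ id).

(* The recursion of [is_bounded_iter] changes the parameter [x], so it is not
   literally an instance of [nno_rec]: run [n] steps of [f] on the state space
   [A + X], then send the unfinished states to divergence. *)
Definition run : ((A + X) × N) ~> (A + X) :=
  nno_rec nat_ob id (copair in1 f).

Definition result : (A + X) ~> A := copair id (diverge ∘ bang).

Definition bounded_iter : (X × N) ~> A := result ∘ run ∘ (in2 ⊗ id).

Lemma run_zero (W : C) (u : W ~> (A + X)) : run ∘ ⟨u, zero nat_ob ∘ bang⟩ = u.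
Proof.
transitivity (run ∘ ⟨id, zero nat_ob ∘ bang⟩ ∘ u); [now cat_norm |].
unfold run; now rewrite nno_zero, id_l.
Qed.

Lemma run_succ : run ∘ (id ⊗ succ nat_ob) = copair in1 f ∘ run.
Proof. apply nno_succ. Qed.

Lemma run_step : run ∘ (copair in1 f ⊗ id) = run ∘ (id ⊗ succ nat_ob).
Proof.
transitivity (nno_rec nat_ob (copair in1 f) (copair in1 f));
  [| symmetry]; apply nno_unique.
- transitivity (run ∘ ⟨copair in1 f, zero nat_ob ∘ bang⟩); [now cat_norm |].
  apply run_zero.
- transitivity (run ∘ (id ⊗ succ nat_ob) ∘ (copair in1 f ⊗ id)); [now cat_norm |].
  now rewrite run_succ, comp_assoc.
- rewrite run_succ, comp_assoc, run_zero; apply id_r.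
- now rewrite run_succ, !comp_assoc, run_succ.
Qed.

Lemma run_in1 : run ∘ (in1 ⊗ id) = in1 ∘ fst.
Proof.
transitivity (nno_rec nat_ob (in1 : A ~> (A + X)) (copair in1 f));
  [| symmetry]; apply nno_unique.
- transitivity (run ∘ ⟨in1 : A ~> (A + X), zero nat_ob ∘ bang⟩); [now cat_norm |].
  apply run_zero.
- transitivity (run ∘ (id ⊗ succ nat_ob) ∘ (in1 ⊗ id)); [now cat_norm |].
  now rewrite run_succ, comp_assoc.
- now cat_norm.
- now cat_norm.
Qed.

Lemma result_run : result ∘ run = copair fst bounded_iter ∘ dstl.
Proof.
apply dstl_ext.
- rewrite comp_assoc, run_in1; unfold result; cat_norm; rewrite dstl_in1; now cat_norm.
- change (bounded_iter = copair fst bounded_iter ∘ dstl ∘ (in2 ⊗ id)).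
  unfold prod_map; rewrite comp_assoc, dstl_in2; now cat_norm.
Qed.

Lemma bounded_iterP : is_bounded_iter bounded_iter.
Proof.
split.
- unfold bounded_iter; rewrite comp_assoc.
  replace ((in2 ⊗ id) ∘ ⟨id, zero nat_ob ∘ bang⟩)
    with ⟨(in2 : X ~> (A + X)), zero nat_ob ∘ bang⟩ by now cat_norm.
  rewrite comp_assoc, run_zero; unfold result; apply copair_in2.
- rewrite <- result_run; unfold bounded_iter.
  transitivity (result ∘ (run ∘ (id ⊗ succ nat_ob)) ∘ (in2 ⊗ id)); [now cat_norm |].
  rewrite <- run_step; now cat_norm.
Qed.

Section Uniqueness.
Variables (b : (X × N) ~> A) (bP : is_bounded_iter b).
Local Notation Z := (A + X)%cat.
Local Notation o := (zero (@nat_ob C)).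
Local Notation s := (succ (@nat_ob C)).

Definition ext_iter : (Z × N) ~> A := copair fst b ∘ dstl.

Lemma ext_iter_in1 (W : C) (u : W ~> A) (v : W ~> N) : ext_iter ∘ ⟨in1 ∘ u, v⟩ = u.
Proof. unfold ext_iter; rewrite comp_assoc, dstl_in1; now cat_norm. Qed.

Lemma ext_iter_in2 (W : C) (u : W ~> X) (v : W ~> N) :
  ext_iter ∘ ⟨in2 ∘ u, v⟩ = b ∘ ⟨u, v⟩.
Proof. unfold ext_iter; rewrite comp_assoc, dstl_in2; now cat_norm. Qed.

Lemma ext_iter_zero : ext_iter ∘ ⟨id, o ∘ bang⟩ = result.
Proof.
destruct bP as [b0 _].
apply copair_ext; rewrite comp_assoc, pair_comp, comp_assoc, bang_comp, id_l;
  unfold result.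
- rewrite <- (id_r in1) at 1; rewrite ext_iter_in1; now cat_norm.
- rewrite <- (id_r in2) at 1; rewrite ext_iter_in2, b0; now cat_norm.
Qed.

Lemma ext_iter_succ : ext_iter ∘ (id ⊗ s) = ext_iter ∘ (copair in1 f ⊗ id).
Proof.
destruct bP as [_ bs].
apply dstl_ext; rewrite !comp_assoc.
- transitivity (ext_iter ∘ ⟨(in1 : A ~> Z) ∘ fst, s ∘ @snd C A N⟩); [now cat_norm |].
  transitivity (ext_iter ∘ ⟨(in1 : A ~> Z) ∘ fst, @snd C A N⟩); [| now cat_norm].
  now rewrite !ext_iter_in1.
- transitivity (ext_iter ∘ ⟨(in2 : X ~> Z) ∘ fst, s ∘ @snd C X N⟩); [now cat_norm |].
  rewrite ext_iter_in2.
  transitivity (b ∘ (id ⊗ s)); [now cat_norm |].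
  rewrite bs; unfold ext_iter; now cat_norm.
Qed.

(* [⟨m, k⟩ ↦ m + k], by recursion on [k]. *)
Definition add : (N × N) ~> N := nno_rec nat_ob id s.

Lemma add_zero (W : C) (u : W ~> N) : add ∘ ⟨u, o ∘ bang⟩ = u.
Proof.
transitivity (add ∘ ⟨id, o ∘ bang⟩ ∘ u); [now cat_norm |].
unfold add; now rewrite nno_zero, id_l.
Qed.

Lemma add_succ : add ∘ (id ⊗ s) = s ∘ add.
Proof. apply nno_succ. Qed.

Lemma succ_add : add ∘ (s ⊗ id) = s ∘ add.
Proof.
transitivity (nno_rec nat_ob s s); [| symmetry]; apply nno_unique.
- transitivity (add ∘ ⟨s, o ∘ bang⟩); [now cat_norm | apply add_zero].
- transitivity (add ∘ (id ⊗ s) ∘ (s ⊗ id)); [now cat_norm |].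
  now rewrite add_succ, comp_assoc.
- rewrite comp_assoc, add_zero; apply id_r.
- now rewrite comp_assoc, add_succ.
Qed.

Lemma zero_add (W : C) : add ∘ ⟨o ∘ bang, snd⟩ = (snd : (W × N) ~> N).
Proof.
transitivity (nno_rec nat_ob (o ∘ bang : W ~> N) s); [| symmetry]; apply nno_unique.
- transitivity (add ∘ ⟨(o ∘ bang : W ~> N), o ∘ bang⟩); [now cat_norm |].
  apply add_zero.
- transitivity (add ∘ (id ⊗ s) ∘ ⟨o ∘ bang, @snd C W N⟩); [now cat_norm |].
  now rewrite add_succ, comp_assoc.
- now cat_norm.
- now cat_norm.
Qed.

Lemma curry_comp (V W D : C) (h : (V × N) ~> D) (k : W ~> V) :
  curry nat_exp h ∘ k = curry nat_exp (h ∘ (k ⊗ id)).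
Proof.
apply curry_unique.
transitivity (ev nat_exp D ∘ (curry nat_exp h ⊗ id) ∘ (k ⊗ id)); [now cat_norm |].
now rewrite ev_curry.
Qed.

Definition shift : exp nat_exp A ~> exp nat_exp A :=
  curry nat_exp (ev nat_exp A ∘ (id ⊗ s)).

Lemma shift_curry (V : C) (h : (V × N) ~> A) :
  shift ∘ curry nat_exp h = curry nat_exp (h ∘ (id ⊗ s)).
Proof.
unfold shift; rewrite curry_comp; f_equal.
transitivity (ev nat_exp A ∘ (curry nat_exp h ⊗ id) ∘ (id ⊗ s)); [now cat_norm |].
now rewrite ev_curry.
Qed.

(* Both sides send [⟨⟨z, k⟩, m⟩] to the value of [ext_iter] at [⟨z, m + k⟩]. *)
Lemma ext_iter_run :
  ext_iter ∘ (run ⊗ id) = ext_iter ∘ ⟨fst ∘ fst, add ∘ ⟨snd, snd ∘ fst⟩⟩.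
Proof.
enough (e : curry nat_exp (ext_iter ∘ (run ⊗ id)) =
  curry nat_exp (ext_iter ∘ ⟨fst ∘ fst, add ∘ ⟨snd, snd ∘ fst⟩⟩)).
{ now rewrite <- (ev_curry nat_exp (ext_iter ∘ (run ⊗ id))), e, ev_curry. }
transitivity (nno_rec nat_ob (curry nat_exp ext_iter) shift);
  [| symmetry]; apply nno_unique.
- rewrite curry_comp; f_equal.
  transitivity (ext_iter ∘ ((run ∘ ⟨id, o ∘ bang⟩) ⊗ id)); [now cat_norm |].
  rewrite run_zero; now cat_norm.
- rewrite curry_comp, shift_curry; f_equal.
  transitivity (ext_iter ∘ ((run ∘ (id ⊗ s)) ⊗ id)); [now cat_norm |].
  rewrite run_succ.
  transitivity (ext_iter ∘ (copair in1 f ⊗ id) ∘ (run ⊗ id)); [now cat_norm |].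
  rewrite <- ext_iter_succ; now cat_norm.
- rewrite curry_comp; f_equal.
  transitivity (ext_iter ∘ ⟨fst, add ∘ ⟨snd, o ∘ bang⟩⟩); [now cat_norm |].
  rewrite add_zero; now cat_norm.
- rewrite curry_comp, shift_curry; f_equal.
  transitivity (ext_iter ∘
    ⟨fst ∘ fst, (add ∘ (id ⊗ s)) ∘ ⟨snd, snd ∘ @fst C (Z × N) N⟩⟩); [now cat_norm |].
  transitivity (ext_iter ∘
    ⟨fst ∘ fst, (add ∘ (s ⊗ id)) ∘ ⟨snd, snd ∘ @fst C (Z × N) N⟩⟩); [| now cat_norm].
  now rewrite add_succ, succ_add.
Qed.

Lemma bounded_iter_unique : b = bounded_iter.
Proof.
assert (e : ext_iter = result ∘ run).
{ transitivity (ext_iter ∘ ⟨fst ∘ fst, add ∘ ⟨snd, snd ∘ fst⟩⟩ ∘ ⟨id, o ∘ @bang C (Z × N)⟩).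
  - transitivity (ext_iter ∘ ⟨fst, add ∘ ⟨o ∘ bang, @snd C Z N⟩⟩); [| now cat_norm].
    rewrite zero_add; now cat_norm.
  - rewrite <- ext_iter_run, <- ext_iter_zero; now cat_norm. }
transitivity (ext_iter ∘ ⟨in2 ∘ fst, snd⟩).
- rewrite ext_iter_in2; now cat_norm.
- rewrite e; unfold bounded_iter; now cat_norm.
Qed.

End Uniqueness.

End Fix_f.
End BoundedIteration.

(* Main.v *)
Require Import Defs.
Local Open Scope cat_scope.

Set Implicit Arguments.
Unset Strict Implicit.
Unset Printing Implicit Defensive.

(** Write [ρ(a, c) = a ⇂ c]. It preserves iteration in its second argument and
    [ρ(a, η z) = a], so it preserves divergence; by uniformity its diagonal
    [ρ(a, a)] is an algebra morphism fixing [η], hence the identity. So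
    [f† ∘ fst ⇂ f⟨†] obeys the recursion defining [f⟨†], which gives (i).

    For (ii), [f†(x)] is also obtained by iterating over [n], from [0] on, the
    search that stops with [f⟨†(x, n+1)] as soon as [f] terminates within [n+1]
    steps. Restricting [g x] to this iteration amounts to restricting it to each
    value returned by the search, and there the hypothesis applies. *)

Section Decisions.
Variable C : AmbientCategory.

Lemma dstr_pair_copair (A B D P Q : C) (u : A ~> D) (v : B ~> D)
    (p : A ~> P) (q : B ~> Q) :
  dstr ∘ ⟨copair u v, p ⊕ q⟩ = copair (in1 ∘ ⟨u, p⟩) (in2 ∘ ⟨v, q⟩).
Proof.
apply copair_ext; rewrite comp_assoc; cat_norm.
- apply dstr_in1.
- apply dstr_in2.
Qed.

(** Only the branch taken by [c] is kept, not the value in it, so that each branch can compute from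
    the whole input. *)
Definition decide (W A B : C) (c : W ~> (A + B)) : W ~> (W + W) :=
  (fst ⊕ fst) ∘ (dstr ∘ ⟨id, c⟩).

Lemma codiag_decide (W A B : C) (c : W ~> (A + B)) : copair id id ∘ decide c = id.
Proof.
assert (e : copair fst fst ∘ dstr = @fst C W (A + B)).
{ apply dstr_ext; cat_norm; rewrite ?dstr_in1, ?dstr_in2; now cat_norm. }
unfold decide; cat_norm; now rewrite <- comp_assoc, e, fst_pair.
Qed.

(** Naturality of [dstr] in its first factor reduces the claim to deciding [id] on [A + B], which
    splits by cases. *)
Lemma decide_natural (W A B : C) (c : W ~> (A + B)) :
  (c ⊕ c) ∘ decide c = (in1 ⊕ in2) ∘ c.
Proof.
assert (nat : (c ⊗ id ⊕ c ⊗ id) ∘ dstr = dstr ∘ (c ⊗ @id C (A + B))).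
{ apply dstr_ext; cat_norm; rewrite ?dstr_in1, ?dstr_in2; now cat_norm. }
transitivity ((fst ⊕ fst) ∘ ((c ⊗ id ⊕ c ⊗ id) ∘ dstr ∘ ⟨id, c⟩)).
- unfold decide; now cat_norm.
- rewrite nat.
  transitivity ((fst ⊕ fst) ∘ (dstr ∘ ⟨copair in1 in2, id ⊕ id⟩ ∘ c)).
  + now cat_norm.
  + rewrite dstr_pair_copair; now cat_norm.
Qed.

Lemma dstr_decide (W A B P Q D : C) (c : W ~> (A + B)) (w : W ~> D)
    (p : W ~> P) (q : W ~> Q) :
  dstr ∘ ⟨w, (p ⊕ q) ∘ decide c⟩ = (⟨w, p⟩ ⊕ ⟨w, q⟩) ∘ decide c.
Proof.
transitivity (dstr ∘ ⟨copair w w, p ⊕ q⟩ ∘ decide c).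
- rewrite comp_assoc, pair_comp.
  replace (copair w w) with (w ∘ copair id id) by now cat_norm.
  now rewrite (comp_assoc w), codiag_decide, id_r.
- now rewrite dstr_pair_copair.
Qed.

End Decisions.

Section Restriction.
Variables (C : AmbientCategory) (K : StableFreeAlgs C).

Lemma restrict_comp (X Y Z W : C) (f : X ~> K Y) (g : X ~> K Z) (h : W ~> X) :
  restrict (f ∘ h) (g ∘ h) = restrict f g ∘ h.
Proof. unfold restrict; now rewrite !comp_assoc, pair_comp. Qed.

Lemma restrict_unit (X Y Z : C) (f : X ~> K Y) (z : X ~> Z) :
  restrict f (eta (K Z) ∘ z) = f.
Proof.
unfold restrict.
transitivity (kleisli (K := K) fst ∘ (strength K (K Y) Z ∘ (id ⊗ eta (K Z))) ∘ ⟨f, z⟩).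
- now cat_norm.
- rewrite (proj1 (strengthP K (K Y) Z)); unfold kleisli; rewrite lift_unit.
  apply fst_pair.
Qed.

Lemma restrict_iter (X Y Z W : C) (f : X ~> K Y) (h : W ~> (K Z + W)) (w : X ~> W) :
  restrict f (h† ∘ w) =
    ((restrict fst snd ⊕ id) ∘ (dstr ∘ (id ⊗ h)))† ∘ ⟨f, w⟩.
Proof.
unfold restrict.
transitivity (kleisli (K := K) fst ∘ (strength K (K Y) Z ∘ (id ⊗ h†)) ∘ ⟨f, w⟩).
- now cat_norm.
- rewrite (proj2 (strengthP K (K Y) Z)); unfold kleisli; rewrite lift_morphism.
  f_equal; f_equal; now cat_norm.
Qed.

(** The loop of [restrict_iter] carries the restricted value along, and [⟨f, id⟩] simulates [k] in
    it; the hypothesis thus makes [f] constant along continuing steps. *)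
Lemma restrict_iter_uniform (Y Z W : C) (f : W ~> K Y) (h : W ~> (K Z + W))
    (k : W ~> (K Y + W)) :
  (restrict fst snd ⊕ id) ∘ (dstr ∘ ⟨f, h⟩) = (id ⊕ ⟨f, id⟩) ∘ k ->
  restrict f (h†) = k†.
Proof.
intros e.
rewrite <- (id_r (h†)), restrict_iter; symmetry; apply iter_uniform.
rewrite <- e; now cat_norm.
Qed.

Lemma restrict_diverge (X Y Z : C) (f : X ~> K Y) :
  restrict f (diverge (K Z) ∘ bang) = diverge (K Y) ∘ bang.
Proof.
unfold diverge; rewrite restrict_iter.
transitivity ((in2 : terminal ~> (K Y + terminal))† ∘ bang ∘ ⟨f, @bang C X⟩);
  [f_equal | now cat_norm].
apply iter_uniform.
replace (dstr ∘ (id ⊗ in2)) with (@in2 C (K Y × K Z) (K Y × terminal)).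
- now cat_norm.
- unfold prod_map; rewrite dstr_in2; now cat_norm.
Qed.

Lemma restrict_idem (X Y : C) (f : X ~> K Y) : restrict f f = f.
Proof.
enough (e : restrict id id = @id C (K Y)).
{ rewrite <- (id_l f) at 1 2; now rewrite restrict_comp, e, id_l. }
transitivity (lift (free_is_free (K Y)) (eta (K Y))).
- apply lift_unique.
  + intros Z h; rewrite <- restrict_comp, id_l.
    apply restrict_iter_uniform.
    (* Unfolding only the first component lets one step of [h] decide both; when it continues,
       [⟨h†, id⟩] reappears at the next state. *)
    rewrite (iter_fixpoint h) at 1.
    replace ⟨copair id (h†) ∘ h, h⟩ with (⟨copair id (h†), id ⊕ id⟩ ∘ h) by now cat_norm.
    rewrite <- (comp_assoc dstr), dstr_pair_copair.
    replace (restrict (@id C (K Y)) id) with (restrict fst snd ∘ ⟨@id C (K Y), id⟩)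
      by now rewrite <- restrict_comp, fst_pair, snd_pair.
    now cat_norm.
  + rewrite <- restrict_comp, id_l.
    rewrite <- (id_r (eta (K Y))) at 2; apply restrict_unit.
- symmetry; apply lift_unique; [intros Z h |]; now cat_norm.
Qed.

End Restriction.

Section Search.
Variables (C : AmbientCategory) (A : UniIterAlg C) (X : C) (f : X ~> (A + X)).
Local Notation N := (nno_ob (@nat_ob C)).
Local Notation s := (succ (@nat_ob C)).

Definition run_next : (X × N) ~> (A + X) := run f ∘ (in2 ⊗ s).

(** On stopping, [bounded_iter f] at [n + 1] agrees with the value found by [run_next], but has the
    form that the hypothesis of (ii) bounds. *)
Definition search : (X × N) ~> (A + X × N) :=
  ((bounded_iter f ∘ (id ⊗ s)) ⊕ (id ⊗ s)) ∘ decide run_next.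

(* Uniformity compares both iterations with the one on [A + X] that takes a step
   of [f] on [X] and returns immediately on [A]. *)
Lemma iter_search : f† = search† ∘ ⟨id, zero nat_ob ∘ bang⟩.
Proof.
set (step := (id ⊕ in2) ∘ copair in1 f : (A + X) ~> (A + (A + X))).
assert (e1 : f† = step† ∘ in2) by (apply iter_uniform; unfold step; now cat_norm).
(* The simulation sends [⟨x, n⟩] to the state reached from [x] after [n] steps of the run. *)
assert (e2 : search† = step† ∘ (run f ∘ ((in2 : X ~> (A + X)) ⊗ id))).
{ apply iter_uniform; unfold search.
  transitivity ((result A X ⊕ id) ∘ ((run_next ⊕ run_next) ∘ decide run_next)).
  - unfold bounded_iter, run_next; now cat_norm.
  - rewrite decide_natural.
    transitivity ((id ⊕ @in2 C A X) ∘ run_next); [unfold result; now cat_norm |].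
    transitivity ((id ⊕ @in2 C A X) ∘ (run f ∘ (id ⊗ s) ∘ ((in2 : X ~> (A + X)) ⊗ id)));
      [unfold run_next; now cat_norm |].
    rewrite run_succ; unfold step; now rewrite !comp_assoc. }
rewrite e1, e2, comp_assoc; f_equal; symmetry.
transitivity (run f ∘ ⟨in2, zero nat_ob ∘ bang⟩); [now cat_norm | apply run_zero].
Qed.

End Search.

Theorem theorem5p15 (C : AmbientCategory) (K : StableFreeAlgs C) (X Y : C)
    (f : X ~> (K Y + X)) (g : X ~> K Y) :
  (bounded_iter f ⊑ f† ∘ fst) /\
  (bounded_iter f ⊑ g ∘ fst -> f† ⊑ g).
Proof.
split.
- unfold below; symmetry; apply bounded_iter_unique.
  destruct (bounded_iterP f) as [b0 bs]; split.
  + rewrite <- restrict_comp, b0; apply restrict_diverge.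
  + rewrite <- restrict_comp, bs, (iter_fixpoint f) at 1.
    transitivity (restrict (copair id (f†) ∘ fst)
      (copair fst (bounded_iter f) ∘ dstl) ∘ (f ⊗ id)).
    * rewrite <- restrict_comp; f_equal; now cat_norm.
    (* If [f] stops, a value is restricted to itself; if it continues, the restriction recurs at the
       next state. *)
    * f_equal; apply dstl_ext; rewrite <- restrict_comp;
        unfold prod_map; rewrite !comp_assoc, ?dstl_in1, ?dstl_in2; cat_norm;
        [apply restrict_idem | reflexivity].
- intros b_below; unfold below in *.
  rewrite (iter_search f); symmetry.
  transitivity (restrict (g ∘ fst) ((search f)†) ∘ ⟨id, zero nat_ob ∘ bang⟩).
  + rewrite <- restrict_comp; f_equal; now cat_norm.
  (* The search never changes [x], so [g ∘ fst] is constant along it. *)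
  + f_equal; apply restrict_iter_uniform.
    unfold search at 1; rewrite dstr_decide.
    set (t := bounded_iter f ∘ (id ⊗ succ nat_ob)).
    (* This is the hypothesis at [n + 1]: precomposing with [id ⊗ succ nat_ob] leaves [g ∘ fst]
       unchanged. *)
    assert (e : restrict fst snd ∘ ⟨g ∘ fst, t⟩ = t).
    { rewrite <- restrict_comp, fst_pair, snd_pair; unfold t.
      rewrite b_below at 2; rewrite <- restrict_comp; f_equal; now cat_norm. }
    transitivity (((restrict fst snd ∘ ⟨g ∘ fst, t⟩) ⊕ ⟨g ∘ fst, id ⊗ succ nat_ob⟩)
      ∘ decide (run_next f)); [now cat_norm |].
    rewrite e; unfold search; fold t; now cat_norm.
Qed.
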